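(* Let $k$ be an algebraically closed field, let $\mathcal{A}$ be a subspace arrangement in $k^n$ embedded in a central hyperplane arrangement $\mathcal{H}$, and let $B_{\mathcal{A},\mathcal{H}}$ be its blocker ideal. Then (1) $\operatorname{rad}(B_{\mathcal{A},\mathcal{H}})=I_{\mathcal{A}^{**}}$; (2) $\operatorname{rad}(B_{\mathcal{A},\mathcal{H}})=I_{\mathcal{A}}$ if and only if $\mathcal{A}^{**}=\mathcal{A}$.
   Context: A subspace arrangement $\mathcal{A}$ in $k^n$ is a finite set of proper linear subspaces, none containing another; $V_{\mathcal{A}}$ is their union and $I_{\mathcal{A}}\subseteq k[x_1,\dots,x_n]$ is the vanishing ideal of $V_{\mathcal{A}}$, i.e. the intersection of the linear ideals defining the subspaces. A central hyperplane arrangement $\mathcal{H}$ is a finite set of hyperplanes defined by linear forms $\ell_1,\dots,\ell_p$; its intersection lattice $L_{\mathcal{H}}$ consists of all intersections of subsets of hyperplanes of $\mathcal{H}$ (including $k^n$), ordered by reverse inclusion, with least element $\hat 0=k^n$; the meet $X\wedge Y$ is the intersection of all hyperplanes of $\mathcal{H}$ containing $X\cup Y$. $\mathcal{A}$ is embedded in $\mathcal{H}$ if each of its subspaces lies in $L_{\mathcal{H}}$. The blocker dual is $\mathcal{A}^*=\min\{X\in L_{\mathcal{H}}\mid C\wedge X\neq\hat 0\text{ for all } C\in\mathcal{A}\}$ (minimal elements), viewed as a subspace arrangement, and $\mathcal{A}^{**}=(\mathcal{A}^* )^*$. For $X\in L_{\mathcal{H}}$ let $Q_X=\prod_{i:\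 \ell_i \text{ vanishes on } X}\ell_i$. The blocker ideal is $B_{\mathcal{A},\mathcal{H}}=(Q_X\mid X\in\mathcal{A}^* )$. *)

(* Defs.v *)
From HB Require Import structures.
From mathcomp Require Import all_boot all_order all_algebra.
From mathcomp Require Import finmap.
From mathcomp Require Import mpoly.

Set Implicit Arguments.
Unset Strict Implicit.
Unset Printing Implicit Defensive.

Import GRing.Theory.

Local Open Scope ring_scope.

Section Ideals.

Variable R : comNzRingType.

Definition ideal_eq (I J : R -> Prop) : Prop := forall f, I f <-> J f.

Definition ideal_gen (T : finType) (g : T -> R) : R -> Prop :=
  fun f => exists c : T -> R, f = \sum_t c t * g t.

Definition radical (I : R -> Prop) : R -> Prop :=
  fun f => exists m : nat, I (f ^+ m).

End Ideals.

Section Arrangements.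

Variables (k : fieldType) (n : nat).

Local Notation V := 'rV[k]_n.

Definition subspace_arrangement (A : {fset {vspace V}}) : Prop :=
  (forall X, X \in A -> X != fullv) /\
  (forall X Y, X \in A -> Y \in A -> (X <= Y)%VS -> X = Y).

Definition arr_union (A : {fset {vspace V}}) : V -> Prop :=
  fun v => exists2 X, X \in A & v \in X.

Definition vanishing_ideal (S : V -> Prop) : {mpoly k[n]} -> Prop :=
  fun f => forall v, S v -> f.@[fun j => v ord0 j] = 0.

Definition arr_ideal (A : {fset {vspace V}}) : {mpoly k[n]} -> Prop :=
  vanishing_ideal (arr_union A).

(* The linear form as a polynomial: its coefficient at 'X_j is its value at
   the j-th standard basis vector. *)
Definition form_mpoly (l : 'Hom(V, k^o)) : {mpoly k[n]} :=
  \sum_(j < n) l (delta_mx ord0 j) *: 'X_j.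

Lemma form_mpolyE (l : 'Hom(V, k^o)) (v : V) :
  (form_mpoly l).@[fun j => v ord0 j] = l v.
Proof.
rewrite {2}[v]row_sum_delta linear_sum /form_mpoly raddf_sum /=.
by apply: eq_bigr => j _; rewrite mevalZ mevalXU linearZ /= mulrC.
Qed.

Variable p : nat.

(* The hyperplanes are the kernels of the forms; injectivity says that each
   hyperplane is listed once, so that the Q_X below are squarefree. *)
Definition hyperplane_arrangement (l : 'I_p -> 'Hom(V, k^o)) : Prop :=
  (forall i, l i != 0) /\ injective (fun i => lker (l i)).

Variable l : 'I_p -> 'Hom(V, k^o).

(* Equal to fullv when S = set0. *)
Definition flat (S : {set 'I_p}) : {vspace V} :=
  (\bigcap_(i in S) lker (l i))%VS.

Definition inter_lattice : {fset {vspace V}} :=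
  [fset flat S | S in {: {set 'I_p}}]%fset.

(* Reverse inclusion. *)
Definition lat_le (X Y : {vspace V}) : bool := (Y <= X)%VS.

Definition lat_meet (X Y : {vspace V}) : {vspace V} :=
  (\bigcap_(i < p | (X <= lker (l i)) && (Y <= lker (l i))) lker (l i))%VS.

Definition minimals (E : {fset {vspace V}}) : {fset {vspace V}} :=
  [fset X in E | [forall Y : E, lat_le (val Y) X ==> (val Y == X)]]%fset.

Definition embedded (A : {fset {vspace V}}) : Prop := {subset A <= inter_lattice}.

Definition blocker_dual (A : {fset {vspace V}}) : {fset {vspace V}} :=
  minimals
    [fset X in inter_lattice | [forall C : A, lat_meet (val C) X != fullv]]%fset.

Definition Q (X : {vspace V}) : {mpoly k[n]} :=
  \prod_(i < p | (X <= lker (l i))%VS) form_mpoly (l i).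

Definition blocker_ideal (A : {fset {vspace V}}) : {mpoly k[n]} -> Prop :=
  ideal_gen (fun X : blocker_dual A => Q (val X)).

End Arrangements.

(* Main.v *)
Require Import Defs.
From HB Require Import structures.
From mathcomp Require Import all_boot all_order all_algebra.
From mathcomp Require Import finmap.
From mathcomp Require Import mpoly ring.

Set Implicit Arguments.
Unset Strict Implicit.
Unset Printing Implicit Defensive.

Import GRing.Theory.

Local Open Scope ring_scope.

(* A point v lies on some member of A^* iff every member of A lies, together with
   v, in one of the hyperplanes: the smallest flat through v then blocks A.  Applied
   to A^* in place of A, this says that the zero set of the blocker ideal is the
   union of A^**.

   Part (1) is then the Nullstellensatz for an ideal I containing products of linear
   forms, which is elementary: if a b is in I, then rad I contains the intersection
   of rad (I + (a)) and rad (I + (b)), and repeated splitting reduces to ideals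
   generated by linear forms, where one substitutes a projection onto their common
   kernel.

   For part (2), each flat X has a point lying on no hyperplane except those that
   contain X, so the zero set of an ideal I_A determines the maximal flats it
   contains, which are the members of A. *)

(** * Points where a nonzero polynomial does not vanish *)

Section IteratedPolynomials.

Variables (R : comNzRingType) (n : nat).

Let widen (i : 'I_n) : 'I_n.+1 := widen_ord (leqnSn n) i.

Lemma meval_muni (p : {mpoly R[n.+1]}) (v : 'I_n.+1 -> R) :
  p.@[v] = (map_poly (meval (v \o widen)) (muni p)).[v ord_max].
Proof.
rewrite muniE mevalE raddf_sum horner_sum /=; apply: eq_bigr => m _.
rewrite big_ord_recr /= mulrA -mul_polyC rmorphM /= map_polyC map_polyXn /=.
rewrite hornerCM hornerXn mevalZ mevalX; congr (_ * _ * _).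
by apply: eq_bigr => i _; rewrite mnmE.
Qed.

(** Widening the coefficients and evaluating at the last variable is a left inverse. *)
Lemma muni_inj : injective (@muni n R).
Proof.
pose back (q : {poly {mpoly R[n]}}) := (mpwiden q).['X_ord_max].
apply: (can_inj (g := back)) => p; rewrite /back muniE {3}[p]mpolyE.
rewrite raddf_sum horner_sum /=; apply: eq_bigr => m _.
rewrite mpwidenZ /mpwiden map_polyXn hornerZ hornerXn mwidenZ mwidenX.
rewrite -scalerAl; congr (_ *: _).
rewrite mpolyXn -mpolyXD; congr 'X_[_]; apply/mnmP => i.
rewrite mnmDE mulmnE mnm1E.
have [->|nei] := eqVneq i ord_max; first by rewrite mnmwiden_ordmax add0n mul1n.
have lti : (i < n)%N by rewrite ltn_neqAle -ltnS ltn_ord andbT.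
have -> : i = widen (Ordinal lti) by apply: val_inj.
by rewrite mnmwiden_widen mnmE mul0n addn0.
Qed.

End IteratedPolynomials.

(** Induction on [n]: where the leading coefficient in the last variable is nonzero, a nonzero
    univariate polynomial remains, and over a closed field it has a nonroot. *)
Lemma mpoly_nonroot (k : closedFieldType) (n : nat) (p : {mpoly k[n]}) :
  p != 0 -> exists v : 'I_n -> k, p.@[v] != 0.
Proof.
elim: n p => [|n IHn] p pN0.
  (* With no variables there is a single monomial, and evaluation returns its coefficient. *)
  exists (fun=> 0); apply: contraNneq pN0 => p0; apply/eqP/mpolyP => m.
  rewrite mcoeff0 -[RHS]p0 mevalE.
  have m0 m' : m' = m by apply/mnmP => -[].
  have [mp|mNp] := boolP (m \in msupp p).
    rewrite (bigD1_seq m) ?msupp_uniq //= big_ord0 mulr1 big1 ?addr0 // => m'.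
    by rewrite (m0 m') eqxx.
  by rewrite big_seq big1 ?memN_msupp_eq0 // => m'; rewrite (m0 m') (negPf mNp).
have uN0 : muni p != 0 by rewrite -(raddf0 (@muni n k)) (inj_eq (@muni_inj k n)).
have [w wN0] := IHn (lead_coef (muni p)) ltac:(by rewrite lead_coef_eq0).
have /closed_nonrootP[x xN] : map_poly (meval w) (muni p) != 0.
  apply: contraNneq wN0 => /polyP/(_ (size (muni p)).-1).
  by rewrite coef_map coef0 => ->.
exists (fun i => if unlift ord_max i is Some j then w j else x).
rewrite meval_muni unlift_none; move: xN; rewrite rootE.
congr (_ != _); congr _.[_]; apply: eq_map_poly => q; apply: meval_eq => i /=.
have -> : widen_ord (leqnSn n) i = lift ord_max i.
  by apply: val_inj; rewrite /= /bump leqNgt ltn_ord.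
by rewrite liftK.
Qed.

(** * Ideals, radicals and congruences *)

Section Ideals.

Variable R : comNzRingType.
Implicit Types (I : R -> Prop) (a b f g : R).

Definition is_ideal I : Prop :=
  [/\ I 0, forall f g, I f -> I g -> I (f + g) & forall f g, I g -> I (f * g)].

Lemma ideal_gen_is_ideal (T : finType) (g : T -> R) : is_ideal (ideal_gen g).
Proof.
split.
- by exists (fun=> 0); rewrite big1 // => t _; rewrite mul0r.
- move=> _ _ [c ->] [d ->]; exists (fun t => c t + d t).
  by rewrite -big_split; apply: eq_bigr => t _; rewrite mulrDl.
- move=> f _ [c ->]; exists (fun t => f * c t).
  by rewrite mulr_sumr; apply: eq_bigr => t _; rewrite mulrA.
Qed.

Lemma ideal_gen_mem (T : finType) (g : T -> R) t : ideal_gen g (g t).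
Proof.
exists (fun u => (u == t)%:R); rewrite (bigD1 t) //= eqxx mul1r big1 ?addr0 //.
by move=> u /negPf ->; rewrite mul0r.
Qed.

Definition add_ideal I a : R -> Prop := fun f => exists r, I (f - r * a).

Lemma add_ideal_is_ideal I a : is_ideal I -> is_ideal (add_ideal I a).
Proof.
case=> I0 ID IM; split.
- by exists 0; rewrite mul0r subr0.
- move=> f g [r Ir] [s Is]; exists (r + s).
  by have := ID _ _ Ir Is; congr I; ring.
- move=> f g [r Ir]; exists (f * r).
  by have := IM f _ Ir; congr I; ring.
Qed.

Lemma sub_add_ideal I a f : I f -> add_ideal I a f.
Proof. by exists 0; rewrite mul0r subr0. Qed.

Lemma mem_add_ideal I a : is_ideal I -> add_ideal I a a.
Proof. by case=> I0 _ _; exists 1; rewrite mul1r subrr. Qed.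

(** With [f ^+ m - r * a] and [f ^+ m' - s * b] in [I], the power [f ^+ (m + m')] equals [f ^+ m' *
    (f ^+ m - r * a) + r * a * (f ^+ m' - s * b) + r * s * (a * b)]. *)
Lemma radical_add_ideal I a b f : is_ideal I -> I (a * b) ->
  radical (add_ideal I a) f -> radical (add_ideal I b) f -> radical I f.
Proof.
case=> I0 ID IM Iab [m [r Ir]] [m' [s Is]]; exists (m + m')%N; rewrite exprD.
have := ID _ _ (ID _ _ (IM (f ^+ m') _ Ir) (IM (r * a) _ Is)) (IM (r * s) _ Iab).
by congr I; ring.
Qed.

Lemma ideal_prod_congr I (T : Type) (s : seq T) (F G : T -> R) :
    is_ideal I -> (forall t, I (F t - G t)) ->
  I (\prod_(t <- s) F t - \prod_(t <- s) G t).
Proof.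
case=> I0 ID IM FG; elim: s => [|t s IHs]; first by rewrite !big_nil subrr.
rewrite !big_cons; have := ID _ _ (IM (F t) _ IHs) (IM (\prod_(u <- s) G u) _ (FG t)).
by congr I; ring.
Qed.

Lemma ideal_sum I (T : Type) (s : seq T) (F : T -> R) :
  is_ideal I -> (forall t, I (F t)) -> I (\sum_(t <- s) F t).
Proof. by case=> I0 ID _ IF; elim/big_ind: _. Qed.

End Ideals.

Lemma comp_mpoly_congr (R : comNzRingType) (n : nat) (I : {mpoly R[n]} -> Prop)
    (h : n.-tuple {mpoly R[n]}) (f : {mpoly R[n]}) :
    is_ideal I -> (forall i, I ('X_i - tnth h i)) -> I (f - (f \mPo h)).
Proof.
move=> idI Ih; rewrite {1}[f]mpolyE comp_mpolyE -sumrB.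
apply: ideal_sum => // m; rewrite -scalerBr -mul_mpolyC.
case: (idI) => _ _; apply; rewrite mpolyXE_id.
(* Powers become constant products, so that the congruence of products applies a second time. *)
apply: ideal_prod_congr => // i; rewrite -[m i]subn0 -!prodr_const_nat.
exact: ideal_prod_congr.
Qed.

(** * The Nullstellensatz for products of linear forms *)

Section Arrangements.

Variables (k : closedFieldType) (n : nat).

Local Notation V := 'rV[k]_n.
Local Notation form := 'Hom(V, k^o).
Implicit Types (a : form) (v : V).

Lemma form_mpoly_neq0 a : a != 0 -> form_mpoly a != 0.
Proof.
apply: contraNneq => a0; apply/eqP/lfunP => v.
by rewrite -form_mpolyE a0 meval0 lfunE.
Qed.

(* With M the matrix of the forms in L and N a pseudo-inverse (M N M = M), the
   endomorphism v - v M N has values in the common kernel of L, and the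
   coordinates of v M N are combinations of the forms in L. *)
Lemma linear_nullstellensatz (L : seq form) (I : {mpoly k[n]} -> Prop)
    (f : {mpoly k[n]}) :
    is_ideal I -> (forall a, a \in L -> I (form_mpoly a)) ->
    (forall v, (forall a, a \in L -> a v = 0) -> f.@[fun j => v ord0 j] = 0) ->
  I f.
Proof.
move=> idI IL f0; case: (idI) => _ _ IM.
pose M : 'M[k]_(n, size L) := \matrix_(i, j) L`_j (delta_mx ord0 i).
have ME v j : (v *m M) ord0 j = L`_j v.
  rewrite mxE {2}[v]row_sum_delta linear_sum; apply: eq_bigr => i _.
  by rewrite mxE linearZ.
pose h := [tuple 'X_i - \sum_(j < size L) pinvmx M j i *: form_mpoly L`_j | i < n].
have hE v i : (tnth h i).@[fun j => v ord0 j] = (v - v *m M *m pinvmx M) ord0 i.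
  rewrite tnth_mktuple mevalB mevalXU 3!mxE; congr (_ - _).
  rewrite (raddf_sum (meval _)).
  by apply: eq_bigr => j _; rewrite /= mevalZ form_mpolyE ME mulrC.
(* Each ['X_i] is congruent to the [i]-th component of [h] modulo [I], hence so is [f] to
   [f \mPo h]; the latter vanishes at every point, so it is zero. *)
suff fh0 : f \mPo h = 0.
  rewrite -[f]subr0 -fh0; apply: comp_mpoly_congr => // i.
  rewrite tnth_mktuple opprB addrC subrK; apply: ideal_sum => // j.
  by rewrite -mul_mpolyC; apply/IM/IL/mem_nth.
apply/eqP; apply: contraT => /mpoly_nonroot[v /negP[]]; apply/eqP.
pose w : V := \row_i v i.
have -> : (f \mPo h).@[v] = f.@[fun i => (w - w *m M *m pinvmx M) ord0 i].
  rewrite comp_mpoly_meval; apply: meval_eq => i; rewrite -hE.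
  by apply: meval_eq => j; rewrite mxE.
apply: f0 => a aL; have lt_a : (index a L < size L)%N by rewrite index_mem.
rewrite -(nth_index 0 aL) -(ME _ (Ordinal lt_a)) mulmxBl.
by rewrite -(mulmxA w M) -(mulmxA w) mulmxKpV // subrr mxE.
Qed.

(** Induction on [T], then on its first product. Splitting off a factor [a] gives two ideals: in
    one, [a] joins [L] and the product is dropped; in the other, the product loses [a]. *)
Lemma linear_products_nullstellensatz (T : seq (seq form)) (L : seq form)
    (I : {mpoly k[n]} -> Prop) (f : {mpoly k[n]}) :
    is_ideal I -> (forall a, a \in L -> I (form_mpoly a)) ->
    (forall s, s \in T -> I (\prod_(a <- s) form_mpoly a)) ->
    (forall v, (forall a, a \in L -> a v = 0) ->
      (forall s, s \in T -> exists2 a, a \in s & a v = 0) ->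
      f.@[fun j => v ord0 j] = 0) ->
  radical I f.
Proof.
elim: T L I => [|s T IHT] L I idI IL IT f0.
  by exists 1%N; rewrite expr1; apply: (linear_nullstellensatz idI IL) => v /f0; apply.
elim: s I idI IL IT f0 => [|a s IHs] I idI IL IT f0.
  (* The empty product puts 1 in [I]. *)
  exists 0%N; rewrite expr0; have := IT [::] (mem_head _ _).
  by rewrite big_nil.
have IT' t : t \in T -> I (\prod_(b <- t) form_mpoly b).
  by move=> tT; apply: IT; apply/predU1P; right.
apply: (@radical_add_ideal _ I (form_mpoly a) (\prod_(b <- s) form_mpoly b)) => //.
- by have := IT (a :: s) (mem_head _ _); rewrite big_cons.
- apply: (IHT (a :: L)).
  + exact: add_ideal_is_ideal.
  + move=> b /predU1P[->|/IL Ib]; first exact: mem_add_ideal.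
    exact: sub_add_ideal.
  + by move=> t /IT' It; apply: sub_add_ideal.
  + move=> v Lv Tv; apply: f0 => [b bL|t /predU1P[->|/Tv//]].
      by apply: Lv; rewrite in_cons bL orbT.
    by exists a; [exact: mem_head | exact/Lv/mem_head].
- apply: IHs.
  + exact: add_ideal_is_ideal.
  + by move=> b /IL Ib; apply: sub_add_ideal.
  + move=> t /predU1P[->|/IT' It]; first exact: mem_add_ideal.
    exact: sub_add_ideal.
  + move=> v Lv Tv; apply: f0 => // t /predU1P[->|tT].
      have [b bs bv] := Tv s (mem_head _ _); exists b => //.
      by rewrite in_cons bs orbT.
    by apply: Tv; apply/predU1P; right.
Qed.

(** * Flats, blockers and the zero set of the blocker ideal *)

Section Lattice.

Variables (p : nat) (l : 'I_p -> form).
Hypothesis l_neq0 : forall i, l i != 0.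
Implicit Types (X Y C : {vspace V}) (A B : {fset {vspace V}}).

Lemma lker_neq_fullv i : lker (l i) != fullv.
Proof.
apply: contraNneq (l_neq0 i) => li; apply/eqP/lfunP => v.
by apply/eqP; rewrite lfunE -memv_ker li memvf.
Qed.

Lemma inter_latticeP X :
  reflect (X = \bigcap_(i | (X <= lker (l i))%VS) lker (l i))%VS
          (X \in inter_lattice l).
Proof.
apply: (iffP idP) => [/imfsetP[S _ ->]|XE].
  apply/eqP; rewrite eqEsubv; apply/andP; split; first exact/subv_bigcapP.
  apply/subv_bigcapP => i iS; apply: (bigcapv_inf i) => //.
  exact: (bigcapv_inf i).
apply/imfsetP; exists [set i | (X <= lker (l i))%VS] => //.
by rewrite {1}XE; apply: eq_bigl => i; rewrite inE.
Qed.

Lemma inter_lattice_mem X v : X \in inter_lattice l ->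
  (forall i, (X <= lker (l i))%VS -> l i v = 0) -> v \in X.
Proof.
move=> /inter_latticeP XE Xv; rewrite XE memvE; apply/subv_bigcapP => i.
by rewrite -memvE memv_ker => /Xv ->.
Qed.

(** The meet is an intersection of proper subspaces, so it is the whole space only when the
    intersection is empty-indexed. *)
Lemma lat_meet_neq_fullv X Y :
  reflect (exists i, (X <= lker (l i))%VS && (Y <= lker (l i))%VS)
          (lat_meet l X Y != fullv).
Proof.
apply: (iffP idP) => [|[i XYi]].
  case: (pickP (fun i => (X <= lker (l i)) && (Y <= lker (l i)))%VS) => [i XYi _|none].
    by exists i.
  by rewrite /lat_meet big_pred0 // eqxx.
apply: contraNneq (lker_neq_fullv i) => meetE.
by rewrite eqEsubv subvf -meetE; apply: (bigcapv_inf i).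
Qed.

Lemma minimalsP A X :
  reflect (X \in A /\ forall Y, Y \in A -> (X <= Y)%VS -> Y = X)
          (X \in minimals A).
Proof.
rewrite !inE; apply: (iffP andP) => -[XA Xmin]; split=> //.
  move=> Y YA XY; apply/eqP.
  by exact: (implyP (forallP Xmin [` YA]%fset)).
by apply/forallP => Y; apply/implyP => XY; apply/eqP/Xmin => //; apply: valP.
Qed.

(** The order is reverse inclusion, so a member of largest dimension among those containing [X] is
    minimal. *)
Lemma minimals_below A X : X \in A ->
  exists2 Y, Y \in minimals A & (X <= Y)%VS.
Proof.
move=> XA; pose P (Y : A) := (X <= val Y)%VS.
have PX : P [` XA]%fset by apply: subvv.
case: (arg_maxnP (fun Y : A => \dim (val Y)) PX) => Y XY Ymax.
exists (val Y) => //; apply/minimalsP; split=> [|Z ZA YZ]; first exact: valP.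
apply/esym/eqP; rewrite eqEdim YZ /=.
exact: (Ymax [` ZA]%fset (subv_trans XY YZ)).
Qed.

(** [blocker_dual l A] unfolds to [minimals (blockers A)]. *)
Definition blockers A : {fset {vspace V}} :=
  [fset X in inter_lattice l | [forall C : A, lat_meet l (val C) X != fullv]]%fset.

Lemma blockersP A X :
  reflect (X \in inter_lattice l /\
           forall C, C \in A -> exists i, (C <= lker (l i))%VS && (X <= lker (l i))%VS)
          (X \in blockers A).
Proof.
rewrite !inE; apply: (iffP andP) => -[XL blk]; split=> //.
  by move=> C CA; apply/lat_meet_neq_fullv/(forallP blk [` CA]%fset).
by apply/forallP => C; apply/lat_meet_neq_fullv/blk/valP.
Qed.

Lemma arr_union_blocker_dual A v :
  arr_union (blocker_dual l A) v <->
  (forall X, X \in A -> exists2 i, (X <= lker (l i))%VS & l i v = 0).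
Proof.
split=> [[Y /minimalsP[/blockersP[_ blk] _] vY] X /blk[i /andP[Xi Yi]]|blk].
  by exists i => //; apply/eqP; rewrite -memv_ker (subvP Yi).
pose F := flat l [set i | l i v == 0].
have vF : v \in F.
  rewrite memvE; apply/subv_bigcapP => i.
  by rewrite inE -memvE memv_ker.
have /minimals_below[Y Ydual FY] : F \in blockers A.
  apply/blockersP; split=> [|X /blk[i Xi /eqP vi]].
    by apply/imfsetP; exists [set i | l i v == 0].
  by exists i; rewrite Xi; apply: (bigcapv_inf i); rewrite ?inE ?vi.
by exists Y => //; apply: (subvP FY).
Qed.

Lemma blocker_dual_antichain A X Y :
  X \in blocker_dual l A -> Y \in blocker_dual l A -> (X <= Y)%VS -> X = Y.
Proof.
by move=> /minimalsP[_ Xmax] /minimalsP[YA _] XY; rewrite (Xmax Y YA XY).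
Qed.

Lemma blocker_dual_embedded A : embedded l (blocker_dual l A).
Proof. by move=> X /minimalsP[/blockersP[]]. Qed.

Lemma radical_blocker_ideal A :
  ideal_eq (radical (blocker_ideal l A))
           (arr_ideal (blocker_dual l (blocker_dual l A))).
Proof.
move=> f; split=> [[m [c fE]] v /arr_union_blocker_dual vA|f0].
  apply/eqP; have : (f ^+ m).@[fun j => v ord0 j] == 0; last first.
    by rewrite rmorphXn expf_eq0 => /andP[].
  (* Every generator [Q l X] has a factor [l i] that vanishes at [v]. *)
  rewrite fE raddf_sum big1 //= => X _; have [i Xi vi] := vA _ (valP X).
  rewrite mevalM rmorph_prod (bigD1 i) //= form_mpolyE vi.
  by rewrite mul0r mulr0.
(* The factors of [Q l X]; the splitting starts with no linear form known to lie in the ideal. *)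
pose forms X := [seq l i | i <- index_enum 'I_p & (X <= lker (l i))%VS].
apply: (linear_products_nullstellensatz
          (T := [seq forms X | X <- blocker_dual l A]) (L := [::])) => //.
- exact: ideal_gen_is_ideal.
- move=> _ /mapP[X XA ->]; rewrite big_map big_filter.
  exact: (ideal_gen_mem (fun X : blocker_dual l A => Q l (val X)) [` XA]%fset).
- move=> v _ vA; apply/f0/arr_union_blocker_dual => X XA.
  have [_ /mapP[i + ->] vi] := vA (forms X) (map_f _ XA).
  by rewrite mem_filter => /andP[Xi _]; exists i.
Qed.

(** * Recovering an arrangement from its ideal *)

(** The forms that do not vanish on [X] stay nonzero when composed with the projection onto [X].
    Their product has a nonroot, whose projection is the point. *)
Lemma generic_point X : exists2 v, v \in X &
  forall i, l i v = 0 -> (X <= lker (l i))%VS.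
Proof.
pose g i : form := (l i \o projv X)%VF.
pose f := \prod_(i | ~~ (X <= lker (l i))%VS) form_mpoly (g i).
have : f != 0.
  apply/prodf_neq0 => i; apply: contraNneq => /eqP g0; apply/subvP => x xX.
  have {g0} : g i == 0 by apply: contraTT g0 => /form_mpoly_neq0.
  move=> /eqP/lfunP/(_ x); rewrite comp_lfunE projv_id // lfunE memv_ker.
  by move=> ->.
case/mpoly_nonroot => u fuN0; pose w : V := \row_j u j.
exists (projv X w); first exact: memv_proj.
move=> i li0; apply: contraNT fuN0 => Xi.
have -> : f.@[u] = f.@[fun j => w ord0 j] by apply: meval_eq => j; rewrite mxE.
by rewrite rmorph_prod (bigD1 i) //= form_mpolyE comp_lfunE li0 mul0r.
Qed.

(** If no [Y] in [B] contains [X], each [Y] lies in a hyperplane avoiding a generic point [v] of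
    [X]. The product of these forms vanishes on [B] but not at [v]. *)
Lemma arr_ideal_sub A B : embedded l A -> embedded l B ->
  (forall f, arr_ideal B f -> arr_ideal A f) ->
  forall X, X \in A -> exists2 Y, Y \in B & (X <= Y)%VS.
Proof.
move=> AL BL BA X XA; have [v vX vgen] := generic_point X.
have [/existsP[Y XY]|none] := boolP [exists Y : B, (X <= val Y)%VS].
  by exists (val Y) => //; apply: valP.
pose sep (Y : B) := [pick i | (val Y <= lker (l i))%VS && (l i v != 0)].
have sepP (Y : B) :
    exists2 i, sep Y = Some i & (val Y <= lker (l i))%VS && (l i v != 0).
  rewrite /sep; case: pickP => [i Yi|noi]; first by exists i.
  case/negP: none; apply/existsP; exists Y.
  rewrite [val Y](inter_latticeP _ (BL _ (valP Y))); apply/subv_bigcapP => i Yi.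
  by apply/vgen/eqP; have := noi i; rewrite Yi /= => /negbFE.
(* By [sepP] the default 0 never occurs. *)
pose f := \prod_(Y : B) if sep Y is Some i then form_mpoly (l i) else 0.
suff : f.@[fun j => v ord0 j] != 0.
  case/eqP; apply: (BA f) => [w [Y YB wY]|]; last by exists X.
  have [i sepY /andP[Yi _]] := sepP [` YB]%fset.
  rewrite rmorph_prod (bigD1 [` YB]%fset) //= sepY form_mpolyE.
  by rewrite (eqP (_ : l i w == 0)) ?mul0r // -memv_ker (subvP Yi).
rewrite rmorph_prod; apply/prodf_neq0 => Y _.
by have [i -> /andP[_ viN0]] := sepP Y; rewrite /= form_mpolyE.
Qed.

(** From [X] in [A], pass to [Y] in [B] above it and to [Z] in [A] above [Y]; then [X = Z] squeezes
    [Y]. *)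
Lemma sub_antichain A B :
    (forall X Y, X \in A -> Y \in A -> (X <= Y)%VS -> X = Y) ->
    (forall X, X \in A -> exists2 Y, Y \in B & (X <= Y)%VS) ->
    (forall X, X \in B -> exists2 Y, Y \in A & (X <= Y)%VS) ->
  {subset A <= B}.
Proof.
move=> antiA AB BA X XA; have [Y YB XY] := AB X XA; have [Z ZA YZ] := BA Y YB.
have XZ := antiA X Z XA ZA (subv_trans XY YZ).
suff -> : X = Y by [].
by apply/eqP; rewrite eqEsubv XY {1}XZ.
Qed.

Lemma arr_ideal_inj A B :
    embedded l A -> embedded l B ->
    (forall X Y, X \in A -> Y \in A -> (X <= Y)%VS -> X = Y) ->
    (forall X Y, X \in B -> Y \in B -> (X <= Y)%VS -> X = Y) ->
  ideal_eq (arr_ideal A) (arr_ideal B) -> A = B.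
Proof.
move=> AL BL antiA antiB AB.
have subAB := arr_ideal_sub AL BL (fun f => (AB f).2).
have subBA := arr_ideal_sub BL AL (fun f => (AB f).1).
by apply/fsetP => X; apply/idP/idP; apply: sub_antichain.
Qed.

End Lattice.

End Arrangements.

Theorem theorem3p11 (k : closedFieldType) (n p : nat)
    (l : 'I_p -> 'Hom('rV[k]_n, k^o)) (A : {fset {vspace 'rV[k]_n}})
    (hH : hyperplane_arrangement l)
    (hA : subspace_arrangement A)
    (hAH : embedded l A) :
  ideal_eq (radical (blocker_ideal l A))
           (arr_ideal (blocker_dual l (blocker_dual l A)))
  /\ (ideal_eq (radical (blocker_ideal l A)) (arr_ideal A)
      <-> blocker_dual l (blocker_dual l A) = A).
Proof.
have [[lN0 _] [_ antiA]] := (hH, hA).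
have radE := radical_blocker_ideal lN0 A.
split=> //; split=> [radA|AE f]; last by rewrite radE AE.
(* By part (1) the two antichains of flats have the same ideal, hence coincide. *)
apply: (arr_ideal_inj (l := l)) => //; first exact: blocker_dual_embedded.
- exact: blocker_dual_antichain.
- by move=> f; rewrite -radE.
Qed.
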